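(* Let $n\ge1$ and define, for $x',y'\in\mathbb R^{n+1}$, $G(x',y'):=G_0(x'-y')$, where $$G_0(x,t):=1_{(0,\infty)}(t)\; t^{-n/2}\exp\Big(-\frac{|x|^2}{4t}\Big),\qquad (x,t)\in\mathbb R^n\times\mathbb R .$$ Then, for every subset $A$ of $\mathbb R^{n+1}$, $$(2n)^{-n}\,m_P(A)\le m_G(A)\le (2/n)^{n/2}\,m_P(A).$$ In particular, $\tfrac12 m_P\le m_G\le\sqrt2\,m_P$ if $n=1$.
   Context: Parabolic Hausdorff measure $m_P$: for $\rho>0$ and $x'\in\mathbb R^{n+1}$ let $P(0,\rho):=[-\rho/2,\rho/2]^n\times[-\rho^2/2,\rho^2/2]$, $P(x',\rho):=x'+P(0,\rho)$. For $A\subset\mathbb R^{n+1}$ and $\delta>0$, $$m_P^\delta(A):=\inf\Big\{\sum_{j=1}^\infty(\operatorname{diam}P(x_j',\rho_j))^n:\ A\subset\bigcup_{j=1}^\infty P(x_j',\rho_j),\ \operatorname{diam}P(x_j',\rho_j)<\delta\Big\},\quad m_P(A):=\lim_{\delta\to0}m_P^\delta(A),$$ where $\operatorname{diam}$ is the Euclidean diameter. Intrinsic Hausdorff measure $m_G$: $B(x',\rho):=\{y'\in\mathbb R^{n+1}: G(x',y')>1/\rho\}$, $$m_G^\delta(A):=\inf\Big\{\sum_{j=1}^\infty\rho_j:\ A\subset\bigcup_{j=1}^\infty B(x_j',\rho_j),\ x_j'\in\mathbb R^{n+1},\ 0<\rho_j<\delta\Big\},\quad m_G(A):=\lim_{\delta\to0}m_G^\delta(A).$$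 *)

(* Defs.v *)
From HB Require Import structures.
From mathcomp Require Export all_boot all_order all_algebra.
From mathcomp Require Export all_classical all_reals all_analysis.

Set Implicit Arguments.
Unset Strict Implicit.
Unset Printing Implicit Defensive.

Import Order.TTheory GRing.Theory Num.Theory.
Import numFieldNormedType.Exports.

Local Open Scope classical_set_scope.
Local Open Scope ring_scope.

Section ParabolicMeasures.
Context {R : realType} {n : nat}.

(* R^{n+1}, written as space-time points (x, t) in R^n x R. *)
Local Notation point := ('rV[R]_n * R)%type.

(* The library norms on 'rV[R]_n and on products are sup norms, hence these
   explicit Euclidean norms on R^n and on R^{n+1}. *)
Definition enorm (x : 'rV[R]_n) : R := Num.sqrt (\sum_(i < n) x 0 i ^+ 2).

Definition penorm (z : point) : R := Num.sqrt (enorm z.1 ^+ 2 + z.2 ^+ 2).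

Definition diam (A : set point) : \bar R :=
  ereal_sup [set (penorm (p.1 - p.2))%:E | p in A `*` A].

Definition G0 (z : point) : R :=
  \1_(`]0, +oo[%classic : set R) z.2 * z.2 `^ (- (n%:R / 2))
  * expR (- (enorm z.1 ^+ 2 / (4 * z.2))).

Definition G (x y : point) : R := G0 (x - y).

Definition P0 (rho : R) : set point :=
  [set z : point | (forall i : 'I_n, - (rho / 2) <= z.1 0 i <= rho / 2) /\
           - (rho ^+ 2 / 2) <= z.2 <= rho ^+ 2 / 2].

Definition P (x : point) (rho : R) : set point := [set x + z | z in P0 rho].

Definition B (x : point) (rho : R) : set point := [set y | rho^-1 < G x y].

Definition mP_delta (delta : R) (A : set point) : \bar R :=
  ereal_inf [set s : \bar R | exists (x : nat -> point) (rho : nat -> R),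
    [/\ forall j, 0 < rho j,
        A `<=` \bigcup_j P (x j) (rho j),
        forall j, (diam (P (x j) (rho j)) < delta%:E)%E &
        s = (\sum_(0 <= j <oo) diam (P (x j) (rho j)) ^+ n)%E]].

Definition mP (A : set point) : \bar R :=
  lim (mP_delta delta A @[delta --> 0^'+]).

Definition mG_delta (delta : R) (A : set point) : \bar R :=
  ereal_inf [set s : \bar R | exists (x : nat -> point) (rho : nat -> R),
    [/\ A `<=` \bigcup_j B (x j) (rho j),
        forall j, 0 < rho j < delta &
        s = (\sum_(0 <= j <oo) (rho j)%:E)%E]].

Definition mG (A : set point) : \bar R :=
  lim (mG_delta delta A @[delta --> 0^'+]).

End ParabolicMeasures.

(* Main.v *)
(* Put [rho = r^n]. The set [B(x, r^n)] consists of the [y] whose time lag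
   [t = x.2 - y.2] and spatial distance [v] to [x] satisfy [t > 0] and
   [t exp (v^2 / (2nt)) < r^2]. Hence [t < r^2] and [v^2 <= (2n/e) r^2], so
   [B(x, r^n)] lies in a parabolic box of side [s] with [s^2 = (8/e) n r^2],
   whose diameter [s sqrt (n + s^2)] is at most [2nr] for small [r] since
   [8/e < 4]; rounding [e] down to [9/4] preserves this. Conversely, a box of
   side [s] lies in a ball with [r^2 = 2 s^2], obtained by placing its time
   interval at lags between [s^2/2] and [3s^2/2], and
   [r^n <= (2/n)^(n/2) diam^n]. *)
Require Import Defs.
From mathcomp Require Import ring lra.

Set Implicit Arguments.
Unset Strict Implicit.
Unset Printing Implicit Defensive.

Import Order.TTheory GRing.Theory Num.Theory.
Import numFieldNormedType.Exports.

Local Open Scope classical_set_scope.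
Local Open Scope ring_scope.

(** * Limits as the scale tends to zero, and an exponential bound *)

Lemma lim_at_right0E (R : realType) (f : R -> \bar R) :
  {homo f : a b / a <= b >-> (b <= a)%E} ->
  lim (f d @[d --> 0^'+]) = ereal_sup (f @` `]0, +oo[).
Proof.
move=> f_anti; apply/cvg_lim => //.
by apply: nonincreasing_at_right_cvge => // a b _ _; exact: f_anti.
Qed.

(** Both limits are suprema over positive scales, so each value of [f] need only be dominated by
    some value of [g], possibly at another scale. *)
Lemma lee_lim_at_right0 (R : realType) (f g : R -> \bar R) (c : R) : 0 < c ->
  {homo f : a b / a <= b >-> (b <= a)%E} ->
  {homo g : a b / a <= b >-> (b <= a)%E} ->
  (forall d, 0 < d -> exists2 d', 0 < d' & (c%:E * f d <= g d')%E) ->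
  (c%:E * lim (f d @[d --> 0^'+]) <= lim (g d @[d --> 0^'+]))%E.
Proof.
move=> c0 f_anti g_anti fg; rewrite !lim_at_right0E// -lee_pdivlMl//.
apply: ge_ereal_sup => _ [d /= + <-]; rewrite in_itv/= andbT => /fg[d' d'0 fgd].
rewrite lee_pdivlMl//; apply: (le_trans fgd); apply: ereal_sup_ubound.
by exists d' => //=; rewrite in_itv/= d'0.
Qed.

(* [9/4] is a convenient lower bound for the optimal constant [e]. *)
Lemma expR_ge_mul (R : realType) (v : R) : 0 <= v -> 9 / 4 * v <= expR v.
Proof.
move=> v0; have := expR_ge1Dx (v / 3).
have -> : expR v = expR (v / 3) ^+ 3 by rewrite -expRM_natl; congr expR; field.
move=> /(lerXn2r 3); rewrite !nnegrE expR_ge0 => /(_ _ isT) le3.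
apply: le_trans (le3 _); last by lra.
(* With [w = v / 3], this product is [(1 + w)^3 - (27/4) w]. *)
have : 0 <= (v / 3 - 2^-1) ^+ 2 * (v / 3 + 4) by rewrite mulr_ge0 ?sqr_ge0//; lra.
nra.
Qed.

Section Comparison.
Context {R : realType} {n : nat}.
Local Notation point := ('rV[R]_n * R)%type.
Implicit Types (x y z : point) (A : set point) (r s d : R).

Lemma mP_delta_anti A :
  {homo (fun d => mP_delta d A) : a b / a <= b >-> (b <= a)%E}.
Proof.
move=> a b ab; apply: le_ereal_inf => t [x [rho [rho0 AP diamP ->]]].
exists x, rho; split => // j; apply: lt_le_trans (diamP j) _.
by rewrite lee_fin.
Qed.

Lemma mG_delta_anti A :
  {homo (fun d => mG_delta d A) : a b / a <= b >-> (b <= a)%E}.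
Proof.
move=> a b ab; apply: le_ereal_inf => t [x [rho [AB rhoa ->]]].
exists x, rho; split => // j; have /andP[-> rhoja] := rhoa j.
exact: lt_le_trans rhoja ab.
Qed.

(** * Parabolic boxes, superlevel sets of [G], and their mutual inclusions *)

Lemma enorm_sqr (v : 'rV[R]_n) : enorm v ^+ 2 = \sum_(i < n) v 0 i ^+ 2.
Proof. by rewrite sqr_sqrtr// sumr_ge0// => i _; exact: sqr_ge0. Qed.

Lemma sum_sqr_le (v : 'rV[R]_n) a : (forall i, - a <= v 0 i <= a) ->
  \sum_(i < n) v 0 i ^+ 2 <= n%:R * a ^+ 2.
Proof.
move=> va; rewrite mulr_natl -[X in _ *+ X]card_ord -sumr_const.
by apply: ler_sum => i _; have := va i; nra.
Qed.

Lemma in_P x s y : P x s y <-> P0 s (y - x).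
Proof.
split=> [[z Pz <-]|Pyx]; first by rewrite addrC addKr.
by exists (y - x) => //; rewrite addrC subrK.
Qed.

Lemma diam_P x s : 0 < s -> diam (P x s) = (s * Num.sqrt (n%:R + s ^+ 2))%:E.
Proof.
move=> s0.
have -> : s * Num.sqrt (n%:R + s ^+ 2)
    = Num.sqrt (n%:R * s ^+ 2 + (s ^+ 2) ^+ 2) :> R.
  rewrite -{1}(gtr0_norm s0) -sqrtr_sqr -sqrtrM ?sqr_ge0//.
  by congr Num.sqrt; ring.
apply/eqP; rewrite eq_le; apply/andP; split.
  apply: ge_ereal_sup => _ [[p q] /= [/in_P [p1 p2] /in_P [q1 q2]] <-].
  rewrite lee_fin; apply: ler_wsqrtr; rewrite enorm_sqr; apply: lerD.
    apply: sum_sqr_le => i; have := p1 i; have := q1 i.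
    by rewrite /= !mxE; lra.
  by move: p2 q2 => /=; nra.
apply: ereal_sup_ubound => /=.
(* Half the main diagonal: the opposite corners [x + c] and [x - c] realise the diameter. *)
pose c : point := (const_mx (s / 2), s ^+ 2 / 2).
have s2 : 0 <= s ^+ 2 by exact: sqr_ge0.
exists (x + c, x - c) => /=.
  by split; apply/in_P; rewrite addrC addKr; split=> [i|] /=; rewrite ?mxE; lra.
congr EFin; congr Num.sqrt; rewrite enorm_sqr /=; congr (_ + _).
  rewrite (eq_bigr (fun=> s ^+ 2)) ?sumr_const ?card_ord ?mulr_natl// => i _.
  by rewrite !mxE; congr (_ ^+ 2); field.
by congr (_ ^+ 2); field.
Qed.

(* Since [G0 (v, t)] is the [n]-th power of [(t exp (|v|^2 / (2nt)))^(-1/2)],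
   the superlevel set at height [r^-n] is described without the power. *)
Lemma in_B x r y : (0 < n)%N -> 0 < r ->
  B x (r ^+ n) y <-> 0 < x.2 - y.2 /\
    (x.2 - y.2) * expR (enorm (x.1 - y.1) ^+ 2 / (2 * n%:R * (x.2 - y.2)))
      < r ^+ 2.
Proof.
move=> n0 r0; rewrite /B /G /G0 /=; set t := _ - _; set q := enorm _ ^+ 2.
have nR : n%:R != 0 :> R by rewrite pnatr_eq0 -lt0n.
rewrite indicE; have [t0|t0] := ltP 0 t; last first.
  rewrite memNset/= ?in_itv/= ?andbT; last by apply/negP; rewrite -leNgt.
  by rewrite !mul0r invr_lt0 ltNge exprn_ge0 ?ltW//; split=> // -[].
rewrite mem_set/= ?in_itv/= ?t0// mul1r.
(* The square root [w] turns the real power into [w ^+ n], so the comparison with [r ^+ n] reduces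
   to [a < r ^+ 2]. *)
set a := t * expR _; pose w := Num.sqrt a.
have a0 : 0 < a by rewrite mulr_gt0// expR_gt0.
have w0 : 0 < w by rewrite sqrtr_gt0.
have -> : t `^ (- (n%:R / 2)) * expR (- (q / (4 * t))) = (w ^+ n)^-1.
  rewrite powRN expRN -invfM; congr (_^-1).
  rewrite /w -powR12_sqrt ?ltW// -powR_mulrn ?powR_ge0// -powRrM mulrC.
  rewrite /a powRM ?expR_ge0 ?ltW// [2^-1 * _]mulrC mulrC; congr (_ * _).
  rewrite -expRM; congr expR; field.
  by rewrite nR gt_eqF.
rewrite ltf_pV2 ?posrE ?exprn_gt0// ltr_pXn2r -?lt0n ?nnegrE ?ltW//.
rewrite -[in X in _ <-> X](sqr_sqrtr (ltW a0)) -/w.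
rewrite ltr_pXn2r ?nnegrE ?ltW//.
by split=> [|[]].
Qed.

(** The side [s] satisfies [s^2 = (32/9) n r^2], so the squared half-side is [(8/9) n r^2], the
    bound on [q] given by [expR_ge_mul]. Lowering the centre by [s^2 / 2] makes the box cover
    exactly the time lags from 0 to [s^2], which exceeds [r^2]. *)
Lemma B_subset_P x r : (0 < n)%N -> 0 < r ->
  B x (r ^+ n) `<=`
    P (x.1, x.2 - 16 / 9 * n%:R * r ^+ 2) (Num.sqrt (32 / 9 * n%:R) * r).
Proof.
move=> n0 r0 y /in_B-/(_ n0 r0); rewrite enorm_sqr.
set t := _ - _; set q := (X in expR (X / _)) => -[t0 tr].
have n1 : 1 <= n%:R :> R by rewrite ler1n.
have q0 : 0 <= q by apply: sumr_ge0 => i _; exact: sqr_ge0.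
have v0 : 0 <= q / (2 * n%:R * t) by rewrite divr_ge0// !mulr_ge0// ltW.
(* The linear bound on [expR] makes [t] cancel, leaving [(9/8) q / n < r^2]. *)
have q_lt : q < 8 / 9 * n%:R * r ^+ 2.
  have := expR_ge_mul v0.
  rewrite -(ler_pM2l t0) => /le_lt_trans/(_ tr).
  have -> : t * (9 / 4 * (q / (2 * n%:R * t))) = 9 / 8 * q / n%:R.
    by field; rewrite !gt_eqF//; lra.
  by rewrite ltr_pdivrMr; lra.
have t_lt : t < r ^+ 2.
  apply: le_lt_trans tr; rewrite ler_peMr ?(ltW t0)//.
  by rewrite -[leLHS]expR0 ler_expR.
have s2 : (Num.sqrt (32 / 9 * n%:R) * r) ^+ 2 = 32 / 9 * n%:R * r ^+ 2.
  by rewrite exprMn sqr_sqrtr//; lra.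
apply/in_P; split=> [i|] /=; last by rewrite s2; move: t_lt t0; rewrite /t; nra.
set s := _ * r in s2 *.
have s0 : 0 <= s by rewrite mulr_ge0 ?sqrtr_ge0 ?ltW.
rewrite -ler_norml -(@ler_pXn2r _ 2)// ?nnegrE ?divr_ge0//.
rewrite real_normK ?num_real// expr_div_n s2 !mxE.
suff : (x.1 0 i - y.1 0 i) ^+ 2 <= q by nra.
rewrite /q (bigD1 i)//= !mxE lerDl; apply: sumr_ge0 => j _; exact: sqr_ge0.
Qed.

Lemma P_subset_B x s : (0 < n)%N -> 0 < s ->
  P x s `<=` B (x.1, x.2 + s ^+ 2) ((Num.sqrt 2 * s) ^+ n).
Proof.
move=> n0 s0 y /in_P[/= y1 y2].
have n1 : 1 <= n%:R :> R by rewrite ler1n.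
have ss : 0 < s ^+ 2 by rewrite exprn_gt0.
apply/in_B => //=; first by rewrite mulr_gt0 ?sqrtr_gt0.
set t := _ - _; have t_ge : s ^+ 2 / 2 <= t by rewrite /t; lra.
have t_le : t <= 3 / 2 * s ^+ 2 by rewrite /t; lra.
split; first by lra.
have q_le : enorm (x.1 - y.1) ^+ 2 <= n%:R * (s / 2) ^+ 2.
  rewrite enorm_sqr; apply: sum_sqr_le => i.
  by have := y1 i; rewrite !mxE; lra.
rewrite exprMn (@sqr_sqrtr _ 2)//.
(* The extreme case is [|v|^2 = n s^2 / 4] at the smallest lag [s^2 / 2]. *)
have e_le : enorm (x.1 - y.1) ^+ 2 / (2 * n%:R * t) <= 4^-1.
  by rewrite ler_pdivrMr ?mulr_gt0//; nra.
(* The factor 4/3 suffices because [(3/2) s^2 * (4/3) = 2 s^2], the squared radius parameter. *)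
have e_lt : expR 4^-1 < 4 / 3 :> R.
  have : 1 + - 4^-1 < expR (- 4^-1) :> R by rewrite expR_gt1Dx//; lra.
  rewrite expRN => lt_inv; rewrite -ltf_pV2 ?posrE ?expR_gt0//.
  by apply: le_lt_trans lt_inv; rewrite invf_div; lra.
apply: (@lt_le_trans _ _ (t * (4 / 3))); last by lra.
rewrite ltr_pM2l; last by lra.
by apply: le_lt_trans e_lt; rewrite ler_expR.
Qed.

(** * Comparison of the two measures by exchanging covers *)

Lemma exists_root r : (0 < n)%N -> 0 < r -> exists2 s, 0 < s & s ^+ n = r.
Proof.
move=> n0 r0; exists (r `^ n%:R^-1); first exact: powR_gt0.
rewrite -powR_mulrn ?powR_ge0// -powRrM mulVf ?powRr1 ?ltW//.
by rewrite pnatr_eq0 -lt0n.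
Qed.

Lemma mP_le_mG A : (0 < n)%N -> (((2 * n%:R) ^- n)%:E * mP A <= mG A)%E.
Proof.
move=> n0; have n1 : 1 <= n%:R :> R by rewrite ler1n.
have c0 : 0 < (2 * n%:R) ^+ n :> R by rewrite exprn_gt0//; lra.
apply: lee_lim_at_right0; rewrite ?invr_gt0//;
  [exact: mP_delta_anti|exact: mG_delta_anti|move=> d d0].
(* For [r <= 3/16] one has [(32/9) (1 + (32/9) r^2) <= 4], with equality at 3/16, hence diameter at
   most [2 n r]; the other bound then keeps this diameter below [d]. *)
pose r0 := Order.min (3 / 16) (d / (2 * n%:R)).
have r00 : 0 < r0 by rewrite lt_min !divr_gt0//; lra.
exists (r0 ^+ n); first by rewrite exprn_gt0.
apply: le_ereal_inf_tmp => _ [x [rho [AB rho0 ->]]].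
have /choice[r rP] j : exists r, 0 < r /\ r ^+ n = rho j.
  by have /andP[/(exists_root n0)[r ? ?] _] := rho0 j; exists r.
have rr0 j : r j < r0.
  have [rj0 rE] := rP j; have /andP[_] := rho0 j.
  by rewrite -rE ltr_pXn2r -?lt0n ?nnegrE// ltW.
pose s j := Num.sqrt (32 / 9 * n%:R) * r j.
have s0 j : 0 < s j by rewrite mulr_gt0 ?(rP j).1// sqrtr_gt0; lra.
have sd j : s j * Num.sqrt (n%:R + s j ^+ 2) <= 2 * n%:R * r j.
  have [rj0 _] := rP j.
  have := rr0 j; rewrite lt_min => /andP[rj _].
  rewrite -(@ler_pXn2r _ 2) ?nnegrE ?mulr_ge0 ?sqrtr_ge0
    ?(ltW (s0 j)) ?(ltW rj0)//.
  rewrite exprMn sqr_sqrtr; last by rewrite addr_ge0 ?sqr_ge0//; lra.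
  have -> : s j ^+ 2 = 32 / 9 * n%:R * r j ^+ 2.
    by rewrite exprMn sqr_sqrtr//; lra.
  have : r j ^+ 2 <= (3 / 16) ^+ 2.
    by rewrite ler_pXn2r ?nnegrE ?ltW//; lra.
  set u := r j ^+ 2 => u_le.
  rewrite exprMn -/u.
  have -> : 32 / 9 * n%:R * u * (n%:R + 32 / 9 * n%:R * u)
    = (n%:R ^+ 2 * u) * (32 / 9 * (1 + 32 / 9 * u)) by ring.
  have -> : (2 * n%:R) ^+ 2 * u = (n%:R ^+ 2 * u) * 4 by ring.
  by rewrite ler_wpM2l ?mulr_ge0 ?sqr_ge0//; lra.
rewrite lee_pdivrMl//.
pose c j : point := ((x j).1, (x j).2 - 16 / 9 * n%:R * r j ^+ 2).
apply: (@le_trans _ _ (\sum_(0 <= j <oo) diam (P (c j) (s j)) ^+ n)%E).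
  apply: ereal_inf_lbound; exists c, s; split => //.
    move=> y /AB[j _ By]; exists j => //; apply: B_subset_P => //.
      exact: (rP j).1.
    by rewrite (rP j).2.
  move=> j; rewrite diam_P// lte_fin; apply: le_lt_trans (sd j) _.
  have := rr0 j; rewrite lt_min => /andP[_].
  by rewrite ltr_pdivlMr; lra.
rewrite -nneseriesZl => [|j _]; last by have /andP[/ltW] := rho0 j.
apply: lee_nneseries => [j _ _|j _]; rewrite diam_P// -EFin_expe lee_fin.
  by rewrite exprn_ge0// mulr_ge0 ?sqrtr_ge0 ?ltW.
have [rj0 <-] := rP j; rewrite -exprMn.
by rewrite lerXn2r ?nnegrE ?mulr_ge0 ?sqrtr_ge0 ?(ltW (s0 j)) ?(ltW rj0).
Qed.

Lemma mG_le_mP A : (0 < n)%N ->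
  (mG A <= ((2 / n%:R) `^ (n%:R / 2))%:E * mP A)%E.
Proof.
move=> n0; have n1 : 1 <= n%:R :> R by rewrite ler1n.
have cE : (2 / n%:R) `^ (n%:R / 2) = (Num.sqrt 2 / Num.sqrt n%:R) ^+ n :> R.
  rewrite -sqrtrV; last by lra.
  rewrite -sqrtrM// -powR_mulrn ?sqrtr_ge0// -powR12_sqrt; last first.
    by rewrite divr_ge0//; lra.
  by rewrite -powRrM mulrC [2^-1 * _]mulrC.
have sn1 : 1 <= Num.sqrt n%:R :> R by rewrite -[leLHS]sqrtr1 ler_sqrt//; lra.
have s2 : 0 < Num.sqrt 2 :> R by rewrite sqrtr_gt0.
have c0 : 0 < (2 / n%:R) `^ (n%:R / 2) :> R by rewrite powR_gt0// divr_gt0//; lra.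
rewrite -lee_pdivrMl//.
apply: lee_lim_at_right0; rewrite ?invr_gt0//;
  [exact: mG_delta_anti|exact: mP_delta_anti|move=> d d0].
have [a a0 aE] := exists_root n0 d0.
(* A box of diameter below [a / sqrt 2] has side [s] below it too, so its ball has radius
   [(sqrt 2 s)^n < a^n = d]. *)
exists (a / Num.sqrt 2); first by rewrite divr_gt0.
apply: le_ereal_inf_tmp => _ [x [s [s0 AP sd ->]]].
(* Keeping only the spatial part of the diameter gives [sqrt 2 * s <= sqrt (2/n) * diam], whose
   [n]-th power is the required constant. *)
have sD j : s j * Num.sqrt n%:R <= s j * Num.sqrt (n%:R + s j ^+ 2).
  by rewrite ler_wpM2l ?(ltW (s0 j))// ler_wsqrtr// lerDl sqr_ge0.
rewrite lee_pdivrMl//.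
apply: (@le_trans _ _ (\sum_(0 <= j <oo) ((Num.sqrt 2 * s j) ^+ n)%:E)%E).
  apply: ereal_inf_lbound.
  exists (fun j => ((x j).1, (x j).2 + s j ^+ 2)), (fun j => (Num.sqrt 2 * s j) ^+ n); split => //.
    by move=> y /AP[j _ Py]; exists j => //; exact: P_subset_B.
  move=> j; rewrite exprn_gt0 ?mulr_gt0//= -aE.
  rewrite ltr_pXn2r -?lt0n ?nnegrE ?mulr_ge0 ?ltW//.
  have := sd j; rewrite diam_P// lte_fin ltr_pdivlMr// => sda.
  rewrite mulrC; apply: le_lt_trans sda; rewrite ler_wpM2r ?(ltW s2)//.
  by apply: le_trans (sD j); rewrite ler_peMr ?(ltW (s0 j)).
rewrite -nneseriesZl => [|j _]; last first.
  by rewrite diam_P// -EFin_expe lee_fin exprn_ge0// mulr_ge0 ?sqrtr_ge0 ?ltW.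
apply: lee_nneseries => [j _ _|j _].
  by rewrite lee_fin exprn_ge0// mulr_ge0 ?ltW.
rewrite diam_P// -EFin_expe -EFinM lee_fin cE -exprMn.
rewrite lerXn2r ?nnegrE ?mulr_ge0 ?invr_ge0 ?sqrtr_ge0 ?(ltW (s0 _))//.
rewrite -mulrA ler_wpM2l ?(ltW s2)// ler_pdivlMl; last by lra.
by rewrite mulrC.
Qed.

End Comparison.

Theorem corollary5p4 (R : realType) :
  (forall (n : nat), (1 <= n)%N -> forall A : set ('rV[R]_n * R),
    (((2 * n%:R : R) ^- n)%:E * mP A <= mG A)%E /\
    (mG A <= ((2 / n%:R : R) `^ (n%:R / 2))%:E * mP A)%E) /\
  (forall A : set ('rV[R]_1 * R),
    ((1 / 2 : R)%:E * mP A <= mG A)%E /\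
    (mG A <= (Num.sqrt (2 : R))%:E * mP A)%E).
Proof.
have main n : (1 <= n)%N -> forall A : set ('rV[R]_n * R),
    (((2 * n%:R : R) ^- n)%:E * mP A <= mG A)%E /\
    (mG A <= ((2 / n%:R : R) `^ (n%:R / 2))%:E * mP A)%E.
  by move=> n0 A; split; [exact: mP_le_mG|exact: mG_le_mP].
split=> // A; have [] := main 1%N isT A.
by rewrite mulr1 expr1 div1r divr1 powR12_sqrt.
Qed.
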